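(* Let $g:H\to H'$ and $q:H\to H$ satisfy assumptions (A1)–(A4) of the context with constants $\sigma_1,\kappa_0,\kappa_1$, and suppose in addition that $q$ is Lipschitz continuous on $H$ with Lipschitz constant $\kappa_q<1$. Let $(x_k)_{k\ge 0}$ be generated by the NGMRES algorithm of the context with maximal depth $m_{max}\ge 1$, and assume the coefficient bound (B) of the context holds with constant $\bar\alpha$. Let $k\ge 1$ and let $m=\min\{m_{max},k\}\ge 1$ be the depth at step $k+1$. Then there is a constant $C$ depending only on $\kappa_0,\kappa_q,\sigma_1,m$ such that $$\|g(x_{k+1})\|_{H'}\le\theta^m_{k+1}\|g(x_k)\|_{H'}+C\bar\alpha^2\sum_{j=k-m}^k\|g(x_j)\|_{H'}^2\quad\text{(whenever } g(x_k)\neq 0),$$ $$\|g(x_{k+1})\|_{H'}\le\gamma^m_{k+1}\,\kappa_1\,\|g(x_k)\|_{H'}+C\bar\alpha^2\sum_{j=k-m}^k\|g(x_j)\|_{H'}^2\quad\text{(whenever } g(q(x_k))\neq 0).$$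
   Context: $(H,\|\cdot\|_H)$ is a Hilbert space and $H'$ its dual, with the dual norm $\|y\|_{H'}=\sup_{0\ne x\in H}\langle y,x\rangle/\|x\|_H$. Assumptions on $g:H\to H'$ and $q:H\to H$: (A1) There is $x^*\in H$ with $g(x^* )=0$ and $q(x^* )=x^*$. (A2) $g$ is Fréchet differentiable on $H$, with derivative at $x$ in direction $h$ denoted $g'(x;h)\in H'$ (linear in $h$), and there is $\sigma_1>0$ with $\|g'(x;h)-g'(y;h)\|_{H'}\le\sigma_1\|x-y\|_H\|h\|_H$ for all $x,y,h\in H$. (A3) $q$ is continuous and there is $\kappa_0>0$ with $\|q(x)-x\|_H\le\kappa_0\|g(x)\|_{H'}$ for all $x\in H$. (A4) There is $\kappa_1>0$ with $\|g(q(x))\|_{H'}\le\kappa_1\|g(x)\|_{H'}$ for all $x\in H$. NGMRES algorithm with maximal depth $m_{max}$: given $x_0\in H$, at step $k+1$ ($k\ge0$) set $m=\min\{m_{max},k\}$; choose real coefficients $(\alpha^{k+1}_{k+1},\alpha^{k+1}_k,\dots,\alpha^{k+1}_{k-m})$ minimizing $$\Big\|\alpha^{k+1}_{k+1}g(q(x_k))+\sum_{j=k-m}^k\alpha^{k+1}_jg(x_j)\Big\|_{H'}^2\quad\text{subject to}\quad\sum_{i=k-m}^{k+1}\alpha^{k+1}_i=1,$$ and set $x_{k+1}=\alpha^{k+1}_{k+1}q(x_k)+\sum_{j=k-m}^k\alpha^{k+1}_jx_j$ (superscripts are iteration indices). (B) There is $\bar\alpha>0$ such that at every step $k+1$, $\sum_{j=k-m}^{k+1}|\alpha^{k+1}_j|\le\bar\alpha$.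 Notation, with $\alpha^{k+1}_j$ the computed minimizing coefficients: $$\theta^m_{k+1}=\frac{\big\|\alpha^{k+1}_{k+1}g(q(x_k))+\sum_{j=k-m}^k\alpha^{k+1}_jg(x_j)\big\|_{H'}}{\|g(x_k)\|_{H'}},\qquad \gamma^m_{k+1}=\frac{\big\|\alpha^{k+1}_{k+1}g(q(x_k))+\sum_{j=k-m}^k\alpha^{k+1}_jg(x_j)\big\|_{H'}}{\|g(q(x_k))\|_{H'}}.$$ *)

(* Defs.v *)
From HB Require Import structures.
From mathcomp Require Import all_boot all_order all_algebra sesquilinear.
From mathcomp Require Import all_classical all_reals all_analysis.

Set Implicit Arguments.
Unset Strict Implicit.
Unset Printing Implicit Defensive.

Import Order.TTheory GRing.Theory Num.Theory.
Import numFieldNormedType.Exports.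

Local Open Scope classical_set_scope.
Local Open Scope ring_scope.

(* Hilbert spaces are real: a Banach space is Hilbert when its norm comes from
   an inner product. *)
Definition hilbert (R : realType) (H : completeNormedModType R) : Prop :=
  exists ip : {dot H for idfun}, forall x : H, `|x| ^+ 2 = ip x x.

Section topological_dual.
Variables (R : realType) (V : normedModType R).

Definition dual_pred : {pred V -> R} :=
  [pred f : V -> R | `[< scalar f /\ continuous f >]].

Record dual := Dual { dual_fun :> V -> R ; dual_funP : dual_fun \in dual_pred }.

HB.instance Definition _ := [isSub for dual_fun].
HB.instance Definition _ := [Choice of dual by <:].

Lemma dual_submod_closed : submod_closed dual_pred.
Proof.
split; first by apply/asboolP; split; [move=> a x y /=; rewrite mulr0 addr0
  | exact: cst_continuous].
move=> a f g /asboolP[fl fc] /asboolP[gl gc]; apply/asboolP; split.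
  move=> b x y; rewrite /= [LHS](_ : _ = a * f (b *: x + y) + g (b *: x + y))//.
  rewrite [in RHS](_ : (a *: f + g) x = a * f x + g x)//.
  rewrite [in RHS](_ : (a *: f + g) y = a * f y + g y)//.
  by rewrite fl gl !mulrDr addrACA mulrCA.
move=> x; apply: continuousD; last exact: gc.
by apply: continuousM; [exact: cst_continuous | exact: fc].
Qed.

HB.instance Definition _ :=
  GRing.isSubmodClosed.Build R (V -> R) dual_pred dual_submod_closed.
HB.instance Definition _ := [SubChoice_isSubLmodule of dual by <:].

Lemma dualP (f : dual) : scalar f /\ continuous f.
Proof. by case: f => f /= /asboolP. Qed.

Lemma dual0E x : (0 : dual) x = 0. Proof. by []. Qed.
Lemma dualDE (f g : dual) x : (f + g) x = f x + g x. Proof. by []. Qed.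
Lemma dualZE a (f : dual) x : (a *: f) x = a * f x. Proof. by []. Qed.

Lemma dualZr (f : dual) a x : f (a *: x) = a * f x.
Proof.
have [fl _] := dualP f.
have f0 : f 0 = 0.
  have := fl 1 0 0; rewrite scaler0 addr0 mul1r.
  by move=> /esym/(canRL (addrK _)); rewrite subrr.
by have := fl a x 0; rewrite f0 !addr0.
Qed.

(* On the zero space the supremum is taken over the empty set, and
   [sup set0 = 0]. *)
Definition dual_norm (f : dual) : R :=
  sup [set f x / `|x| | x in [set x : V | x != 0]].

Lemma dual_norm_has_ub (f : dual) :
  has_ubound [set f x / `|x| | x in [set x : V | x != 0]].
Proof.
have [fl fc] := dualP f.
pose F := GRing.isLinear.Build R V R^o *%R f fl.
pose fL : {linear V -> R^o} := HB.pack (f : V -> R^o) F.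
have fLc : continuous fL by exact: fc.
have /linear_boundedP/pinfty_ex_gt0[M M0 fM] :=
  @continuous_linear_bounded _ _ _ 0 fL (fLc 0).
exists M => _ [x /= x0 <-].
rewrite ler_pdivrMr ?normr_gt0//.
exact: le_trans (ler_norm _) (fM x).
Qed.

Lemma dual_le (f : dual) x : `|f x| <= dual_norm f * `|x|.
Proof.
have fle y : f y <= dual_norm f * `|y|.
  have [->|y0] := eqVneq y 0.
    by rewrite normr0 mulr0 -(scale0r 0) dualZr mul0r.
  rewrite -ler_pdivrMr ?normr_gt0//; apply: (ub_le_sup (dual_norm_has_ub f)).
  by exists y.
rewrite ler_norml fle andbT lerNl.
by have := fle (-1 *: x); rewrite dualZr mulN1r scaleN1r normrN.
Qed.

Lemma dual_norm_le (f : dual) M : 0 <= M ->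
  (forall x, f x <= M * `|x|) -> dual_norm f <= M.
Proof.
move=> M0 fM; rewrite /dual_norm.
set E := (X in sup X).
have [->|/set0P E0] := eqVneq E set0; first by rewrite sup0.
apply: ge_sup => // _ [x /= x0 <-].
by rewrite ler_pdivrMr ?normr_gt0.
Qed.

Lemma dual_norm_ge0 (f : dual) : 0 <= dual_norm f.
Proof.
have [[x x0]|V0] := pselect (exists x : V, x != 0).
  have := le_trans (normr_ge0 _) (dual_le f x).
  by rewrite pmulr_lge0 ?normr_gt0.
rewrite /dual_norm (_ : [set _ | _ in _] = set0) ?sup0//.
by rewrite -subset0 => _ [x /= x0 _]; apply: V0; exists x.
Qed.

Lemma dual_normD (f g : dual) : dual_norm (f + g) <= dual_norm f + dual_norm g.
Proof.
apply: dual_norm_le => [|x]; first by rewrite addr_ge0 ?dual_norm_ge0.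
by rewrite dualDE mulrDl lerD// (le_trans (ler_norm _) (dual_le _ _)).
Qed.

Lemma dual_normZ a (f : dual) : dual_norm (a *: f) = `|a| * dual_norm f.
Proof.
have le b (h : dual) : dual_norm (b *: h) <= `|b| * dual_norm h.
  apply: dual_norm_le => [|x]; first by rewrite mulr_ge0 ?dual_norm_ge0.
  rewrite dualZE (le_trans (ler_norm _))// normrM -mulrA ler_wpM2l//.
  exact: dual_le.
have [->|a0] := eqVneq a 0.
  apply/eqP; rewrite eq_le normr0 mul0r dual_norm_ge0 andbT.
  by rewrite (le_trans (le _ _))// normr0 mul0r.
apply/eqP; rewrite eq_le le/=.
have := le a^-1 (a *: f); rewrite scalerA mulVf// scale1r normfV.
by rewrite ler_pdivlMl ?normr_gt0.
Qed.

Lemma dual_norm0_eq0 (f : dual) : dual_norm f = 0 -> f = 0.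
Proof.
move=> f0; apply/val_inj/funext => x /=; apply/eqP.
by rewrite -normr_le0 (le_trans (dual_le f x))// f0 mul0r.
Qed.

HB.instance Definition _ := @Lmodule_isNormed.Build R dual
  dual_norm dual_normD dual_normZ dual_norm0_eq0.

Lemma dual_normE (f : dual) :
  `|f| = sup [set f x / `|x| | x in [set x : V | x != 0]].
Proof. by []. Qed.

End topological_dual.

Section ngmres.
Variables (R : realType) (H : completeNormedModType R).

(* A coefficient family at step k+1 is a function [a : nat -> R] of which only
   the entries a (k-m), ..., a (k+1) are relevant. *)

Definition affine_coef (m k : nat) (a : nat -> R) : Prop :=
  \sum_(k - m <= i < k.+2) a i = 1.

(* [u] carries the coefficient of index k+1, i.e. that of q(x_k). *)
Definition window_comb (W : lmodType R) (m k : nat) (a : nat -> R)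
    (u : W) (v : nat -> W) : W :=
  a k.+1 *: u + \sum_(k - m <= j < k.+1) a j *: v j.

Definition residual (g : H -> dual H) (q : H -> H) (x : nat -> H) (m k : nat)
    (a : nat -> R) : dual H :=
  window_comb m k a (g (q (x k))) (fun j => g (x j)).

Definition depth (mmax k : nat) : nat := minn mmax k.

(* [alpha n j] is the coefficient of index j chosen at step n, n >= 1. *)
Definition ngmres (g : H -> dual H) (q : H -> H) (mmax : nat)
    (x : nat -> H) (alpha : nat -> nat -> R) : Prop :=
  forall k : nat, let m := depth mmax k in
  [/\ affine_coef m k (alpha k.+1),
      forall a, affine_coef m k a ->
        `|residual g q x m k (alpha k.+1)| ^+ 2 <= `|residual g q x m k a| ^+ 2
    & x k.+1 = window_comb m k (alpha k.+1) (q (x k)) x].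

Definition coef_bounded (mmax : nat) (alpha : nat -> nat -> R) (abar : R) :=
  forall k : nat,
    \sum_(k - depth mmax k <= j < k.+2) `|alpha k.+1 j| <= abar.

(* The values at step k+1. *)
Definition theta (g : H -> dual H) (q : H -> H) (x : nat -> H)
    (alpha : nat -> nat -> R) (m k : nat) : R :=
  `|residual g q x m k (alpha k.+1)| / `|g (x k)|.

Definition gamma (g : H -> dual H) (q : H -> H) (x : nat -> H)
    (alpha : nat -> nat -> R) (m k : nat) : R :=
  `|residual g q x m k (alpha k.+1)| / `|g (q (x k))|.

End ngmres.

(* Main.v *)
(* Expand [g] to first order at [x k].  The weights sum to 1, so in the
   difference between [g (x k.+1)] and the minimized residual the terms of order
   0 and 1 cancel, leaving quadratic remainders in the distances of [q (x k)] and
   of the [x j] to [x k].  Since [q] is a contraction,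
   (1 - kappaq) |x j - x k| <= |q (x j) - x j| + |q (x k) - x k|, and (A3) bounds
   the right-hand side by the norms of the [g (x j)]. *)
Require Import Defs.
From HB Require Import structures.
From mathcomp Require Import all_boot all_order all_algebra sesquilinear.
From mathcomp Require Import all_classical all_reals all_analysis.
From mathcomp Require Import ring.

Set Implicit Arguments.
Unset Strict Implicit.
Unset Printing Implicit Defensive.

Import Order.TTheory GRing.Theory Num.Theory.
Import numFieldNormedType.Exports.

Local Open Scope classical_set_scope.
Local Open Scope ring_scope.

Section quadratic_remainder.
Variables (R : realType) (H : completeNormedModType R).

(** Evaluation at [v] is linear and bounded by [|v|], hence its own differential. It turns the
    [dual H]-valued [g] into real functions, to which the mean value theorem applies. *)
Lemma is_diff_dual_eval (v : H) (f : dual H) :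
  is_diff f (fun u : dual H => u v : R^o) (fun u => u v).
Proof.
pose ev : dual H -> R^o := fun u => u v.
have ev_lin : scalar ev by [].
pose F := GRing.isLinear.Build R (dual H) R^o *%R ev ev_lin.
pose evL : {linear dual H -> R^o} := HB.pack ev F.
have ev_cont : continuous evL.
  apply/linear_bounded_continuous/linear_boundedP.
  exists `|v|; split=> [|M /ltW vM u]; first exact: num_real.
  rewrite (le_trans (dual_le u v))// mulrC.
  by apply: ler_pM; rewrite ?dual_norm_ge0.
apply: DiffDef.
  exact: (linear_differentiable (f := evL) _ ev_cont).
exact: (diff_lin (f := evL) _ ev_cont).
Qed.

Variables (g : H -> dual H) (sigma : R).
Hypothesis g_diff : forall y, differentiable g y.

(** Chain rule through the line [s => c + s *: h], then [g], then evaluation at [v]. *)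
Lemma is_derive_dual_segment (c h v : H) (t : R) :
  is_derive t 1 (fun s : R => g (c + s *: h) v) ('d g (c + t *: h) h v).
Proof.
have line_diff : is_diff t (fun s : R => c + s *: h) (fun s => s *: h).
  apply: (@is_diff_eq _ _ _ (cst c + (fun s : R => s *: h)) (0 + (fun s => s *: h))).
  by rewrite add0r.
have gD : is_diff (c + t *: h) g ('d g (c + t *: h)) by exact/differentiableP.
pose phi (s : R) : R := g (c + s *: h) v.
have phiD : is_diff t phi (fun s => 'd g (c + t *: h) (s *: h) v).
  exact: is_diff_comp (is_diff_comp line_diff gD) (is_diff_dual_eval v _).
have phi_diff : differentiable phi t by exact: ex_diff.
apply: DeriveDef; first exact: diff_derivable.
by rewrite deriveE// diff_val /= scale1r.
Qed.

Hypothesis sigma_ge0 : 0 <= sigma.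
Hypothesis g_lip : forall y z h : H,
  `|'d g y h - 'd g z h| <= sigma * `|y - z| * `|h|.

(** By definition of the dual norm it suffices to bound the value at each [v], where the mean value
    theorem on [[0, 1]] applies. The intermediate point depends on [v], but the bound does not. *)
Lemma taylor_remainder_le (c y : H) :
  `|g y - g c - 'd g c (y - c)| <= sigma * `|y - c| ^+ 2.
Proof.
set h := y - c.
apply: dual_norm_le => [|v]; first by rewrite mulr_ge0 ?exprn_ge0.
pose phi (s : R) := g (c + s *: h) v.
have dphi (s : R) : is_derive s 1 phi ('d g (c + s *: h) h v).
  exact: is_derive_dual_segment.
have [|t /[!in_itv]/= /andP[t0 t1]] :=
  MVT_segment (ler01 : (0 : R) <= 1) (fun s _ => dphi s).
  apply: derivable_within_continuous => s _.
  exact: (@ex_derive _ _ _ _ _ _ _ (dphi s)).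
rewrite /phi scale1r scale0r addr0 subr0 mulr1 /h subrKC -/h => mvt.
rewrite [leLHS](_ : _ = ('d g (c + t *: h) h - 'd g c h) v); last first.
  by rewrite -[LHS]/(g y v - g c v - 'd g c h v) mvt.
rewrite (le_trans (ler_norm _))// (le_trans (dual_le _ _))// ler_wpM2r//.
(* The two base points differ by [t *: h] with [0 <= t <= 1]. *)
rewrite (le_trans (g_lip _ _ _))// [c + _]addrC addrK normrZ ger0_norm//.
by rewrite expr2 -mulrA ler_wpM2l// ler_wpM2r// ler_piMl.
Qed.

(** The factor 2 counts two contributions: the remainder at the combination, which lies within
    [A * M] of [c], and the weighted sum of the remainders at the [y i]. *)
Lemma affine_comb_defect_le (I : eqType) (r : seq I) (a : I -> R) (y : I -> H)
    (c : H) (A M : R) :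
  \sum_(i <- r) a i = 1 -> \sum_(i <- r) `|a i| <= A ->
  (forall i, i \in r -> `|y i - c| <= M) ->
  `|g (\sum_(i <- r) a i *: y i) - \sum_(i <- r) a i *: g (y i)|
    <= 2 * sigma * A ^+ 2 * M ^+ 2.
Proof.
move=> a1 aA yM.
set X := \sum_(i <- r) a i *: y i.
pose rem z := g z - g c - 'd g c (z - c).
have Xc : X - c = \sum_(i <- r) a i *: (y i - c).
  rewrite (eq_bigr (fun i => a i *: y i - a i *: c)); last first.
    by move=> i _; rewrite scalerBr.
  by rewrite big_split/= sumrN -scaler_suml a1 scale1r.
have -> : g X - \sum_(i <- r) a i *: g (y i)
    = rem X - \sum_(i <- r) a i *: rem (y i).
  rewrite [in RHS](eq_bigr (fun i => a i *: g (y i) - a i *: g c -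
      'd g c (a i *: (y i - c)))); last first.
    by move=> i _; rewrite [X in _ = _ - X]linearZ/= -!scalerBr.
  rewrite !big_split/= !sumrN -scaler_suml a1 scale1r.
  rewrite -linear_sum -Xc /rem.
  by rewrite -(addrA (g X)) -(addrA (\sum_(i <- r) _)) -!opprD opprB addrA subrK.
(* This lets the factor [A] of the second contribution be raised to [A ^+ 2]. *)
have A1 : 1 <= A.
  by rewrite -a1 (le_trans _ aA)// ler_sum// => i _; exact: ler_norm.
have rem_le z B : `|z - c| <= B -> `|rem z| <= sigma * B ^+ 2.
  move=> zB; rewrite (le_trans (taylor_remainder_le _ _))// ler_wpM2l//.
  by rewrite lerXn2r ?nnegrE// (le_trans _ zB).
(* The sign of [M] comes from any index in [r]; one exists because an empty sum is not 1. *)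
have M_ge0 : r != [::] -> 0 <= M.
  by case: r yM {a1 aA X Xc} => // i r' yM _; rewrite (le_trans _ (yM i _)) ?mem_head.
have {}M_ge0 : 0 <= M.
  by apply: M_ge0; apply: contra_eq_neq a1 => ->; rewrite big_nil eq_sym oner_neq0.
have weighted_le (W : normedModType R) (w : I -> W) B : 0 <= B ->
    (forall i, i \in r -> `|w i| <= B) -> `|\sum_(i <- r) a i *: w i| <= A * B.
  move=> B0 wB; apply: (@le_trans _ _ ((\sum_(i <- r) `|a i|) * B)); last first.
    by rewrite ler_wpM2r.
  rewrite mulr_suml (le_trans (ler_norm_sum _ _ _))// big_seq [leRHS]big_seq.
  by apply: ler_sum => i ir; rewrite normrZ ler_wpM2l// wB.
rewrite (le_trans (ler_normB _ _))//.
have -> : 2 * sigma * A ^+ 2 * M ^+ 2 =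
    sigma * (A * M) ^+ 2 + A ^+ 2 * (sigma * M ^+ 2) by ring.
apply: lerD; first by rewrite rem_le// Xc weighted_le.
have sM0 : 0 <= sigma * M ^+ 2 by rewrite mulr_ge0 ?sqr_ge0.
apply: (@le_trans _ _ (A * (sigma * M ^+ 2))).
  by apply: weighted_le => // i ir; exact/rem_le/yM.
by rewrite ler_wpM2r// expr2 ler_peMl// (le_trans _ A1).
Qed.

End quadratic_remainder.

(** Split [y - z] as [(y - q y) + (q z - z) + (q y - q z)] and absorb the last term on the left. *)
Lemma contraction_dist_le (R : realType) (H : normedModType R) (q : H -> H)
    (kappaq e f : R) (y z : H) :
  kappaq < 1 -> `|q y - q z| <= kappaq * `|y - z| ->
  `|q y - y| <= e -> `|q z - z| <= f -> `|y - z| <= (e + f) / (1 - kappaq).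
Proof.
move=> kq1 qyz qy qz; rewrite ler_pdivlMr ?subr_gt0// mulrC mulrBl mul1r lerBlDr.
rewrite [leLHS](_ : _ = `|(y - q y) + (q z - z) + (q y - q z)|); last first.
  by rewrite addrAC !subrKA.
rewrite (le_trans (ler_normD _ _))// lerD// (le_trans (ler_normD _ _))// lerD//.
by rewrite distrC.
Qed.

(** With [f] the identity and [f = g], this writes the new iterate and the residual as sums over the
    same points with the same weights. *)
Lemma window_combE (R : realType) (H W : lmodType R) (m k : nat) (a : nat -> R)
    (f : H -> W) (u : H) (x : nat -> H) :
  window_comb m k a (f u) (fun j => f (x j)) =
  \sum_(k - m <= j < k.+2) a j *: f (if j == k.+1 then u else x j).
Proof.
rewrite /window_comb [in RHS]big_nat_recr/=; last by rewrite leqW// leq_subr.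
rewrite eqxx addrC; congr (_ + _); apply: eq_big_nat => j /andP[_ jk].
by rewrite ltn_eqF.
Qed.

Theorem theorem3p8 (R : realType) (kappa0 kappaq sigma1 : R) (m : nat) :
  exists C : R,
  forall (H : completeNormedModType R) (g : H -> dual H) (q : H -> H)
    (kappa1 abar : R) (mmax : nat) (x : nat -> H) (alpha : nat -> nat -> R)
    (k : nat),
  hilbert H ->
  (exists xs : H, g xs = 0 /\ q xs = xs) ->
  (forall y : H, differentiable g y) ->
  0 < sigma1 ->
  (forall y z h : H, `|'d g y h - 'd g z h| <= sigma1 * `|y - z| * `|h|) ->
  continuous q ->
  0 < kappa0 ->
  (forall y : H, `|q y - y| <= kappa0 * `|g y|) ->
  0 < kappa1 ->
  (forall y : H, `|g (q y)| <= kappa1 * `|g y|) ->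
  kappaq.-lipschitz q ->
  kappaq < 1 ->
  (1 <= mmax)%N ->
  ngmres g q mmax x alpha ->
  0 < abar ->
  coef_bounded mmax alpha abar ->
  (1 <= k)%N ->
  m = depth mmax k ->
  (g (x k) != 0 ->
    `|g (x k.+1)| <= theta g q x alpha m k * `|g (x k)|
      + C * abar ^+ 2 * \sum_(k - m <= j < k.+1) `|g (x j)| ^+ 2) /\
  (g (q (x k)) != 0 ->
    `|g (x k.+1)| <= gamma g q x alpha m k * kappa1 * `|g (x k)|
      + C * abar ^+ 2 * \sum_(k - m <= j < k.+1) `|g (x j)| ^+ 2).
Proof.
(* The summand 1 covers [q (x k)], by (A3); the other covers the [x j], by contraction with two (A3)
   bounds. *)
pose K := kappa0 * (1 + 2 / (1 - kappaq)).
exists (2 * sigma1 * K ^+ 2) => H g q kappa1 abar mmax x alpha k.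
move=> _ _ g_diff s0 g_lip _ k0 q_near k1 gq_le q_lip kq1 _ algo _ a_bnd _ mE.
have := algo k; rewrite /= -mE => -[aff _ xE].
set S := \sum_(k - m <= j < k.+1) _.
(* Both claims reduce to this: [theta] and [gamma] are the residual norm divided by a nonzero norm,
   and for [gamma] (A4) bounds that norm. *)
suff step : `|g (x k.+1)| <= `|residual g q x m k (alpha k.+1)|
    + 2 * sigma1 * K ^+ 2 * abar ^+ 2 * S.
  split=> gk0; rewrite (le_trans step)// lerD2r.
    by rewrite /theta divfK ?normr_eq0.
  rewrite /gamma -mulrA -{1}[`|residual _ _ _ _ _ _|](@divfK _ `|g (q (x k))|) ?normr_eq0//.
  by rewrite ler_wpM2l.
(* The common bound is the square root of the sum of squares, so that squaring the radius
   [K * Num.sqrt S] gives exactly [K ^+ 2 * S]. *)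
have gS j : (k - m <= j < k.+1)%N -> `|g (x j)| <= Num.sqrt S.
  move=> jk; rewrite -[leLHS]normr_id -sqrtr_sqr ler_wsqrtr//.
  rewrite /S (bigD1_seq j) ?mem_index_iota ?iota_uniq//=.
  by rewrite lerDl sumr_ge0// => i _; rewrite exprn_ge0.
have kk : (k - m <= k < k.+1)%N by rewrite leq_subr ltnSn.
have near_k j : (k - m <= j < k.+1)%N -> `|q (x j) - x j| <= kappa0 * Num.sqrt S.
  by move=> jk; rewrite (le_trans (q_near _))// ler_pM2l// gS.
have S0 : 0 <= S by rewrite sumr_ge0// => i _; rewrite exprn_ge0.
pose y j := if j == k.+1 then q (x k) else x j.
have yM j : j \in index_iota (k - m) k.+2 -> `|y j - x k| <= K * Num.sqrt S.
  have KE : K * Num.sqrt S = kappa0 * Num.sqrt S +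
      (kappa0 * Num.sqrt S + kappa0 * Num.sqrt S) / (1 - kappaq).
    by rewrite /K; ring.
  have e0 : 0 <= kappa0 * Num.sqrt S by rewrite mulr_ge0 ?sqrtr_ge0// ltW.
  rewrite mem_index_iota /y KE => /andP[mj]; rewrite ltnS leq_eqVlt.
  case: eqVneq => [_ _|_ /= jk].
    rewrite (le_trans (near_k _ kk))// lerDl divr_ge0 ?subr_ge0 ?(ltW kq1)// addr_ge0//.
  apply: ler_wpDl => //; apply: (contraction_dist_le kq1 (q_lip (x j, x k) _)) => //.
    by apply: near_k; rewrite mj.
  exact: near_k.
have := affine_comb_defect_le g_diff (ltW s0) g_lip aff _ yM.
have {}a_bnd := a_bnd k; rewrite -mE in a_bnd.
move=> /(_ _ a_bnd).
rewrite -(window_combE m k (alpha k.+1) id) -(window_combE m k (alpha k.+1) g).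
rewrite -xE -/(residual _ _ _ _ _ _) exprMn sqr_sqrtr// => defect.
(* The reverse triangle inequality passes from the defect to the difference of norms. *)
rewrite -lerBlDl (le_trans (lerB_dist _ _))// (le_trans defect)//.
by rewrite le_eqVlt; apply/orP; left; apply/eqP; ring.
Qed.
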